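(* Let $\{y^k\}$, $\{\bar y^{k+1}\}$ be generated by the safeguarded projected-gradient algorithm described in the context, from $y^0\in\mathcal C$. Suppose that: - there are constants $\underline\alpha,\overline\alpha$ with $0<\underline\alpha\le\alpha_k\le\overline\alpha<1/L$ for all $k$; - $\mathcal S\ne\varnothing$; - the level set $\mathcal L_0:=\{y\in\mathcal C:\Phi(y)\le\Phi(y^0)\}$ is bounded; - $\bigcup_{\alpha>0}\{y\in\mathcal C: y\in\Pi_{\mathcal C}(y-\alpha\nabla\Phi(y))\}\subseteq\mathcal S$; - $\alpha_k\in\mathcal A$ for all $k$, where $\mathcal A\subseteq[\underline\alpha,\overline\alpha]$ is finite and nonempty. Let $\kappa_r>0$ satisfy $\operatorname{dist}(y,\mathcal S)\le\kappa_r\|Hy-c\|$ for all $y\in\mathcal L_0$. Let $\kappa_G>0$ satisfy $\operatorname{dist}(y,\mathcal S)\le\kappa_G\,g_\alpha(y)$ for all $y\in\mathcal L_0$, $\alpha\in\mathcal A$, with $\kappa_G$ enlarged, if necessary, so that $\eta:=2c_d\underline\alpha^2/(L\kappa_G^2)\in(0,1)$, and put $\theta:=1-\eta\in(0,1)$. Set $C_0:=\kappa_r\sqrt{2\Phi(y^0)}$. If $\gamma_{\mathcal S}<+\infty$, let $K_{\rm id}$ be the smallest nonnegative integer satisfying $C_0\theta^{K_{\rm id}/2}<\gamma_{\mathcal S}$; otherwise set $K_{\rm id}=0$. Then, for every $k\ge K_{\rm id}$, $$F(y^k),\ F(\bar y^{k+1})\in\mathfrak F_{\mathcal S}.$$ If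 $\gamma_{\mathcal S}<+\infty$, then $$K_{\rm id}\le 1+\left\lceil\frac{2\log\left(\max\{1,2C_0/\gamma_{\mathcal S}\}\right)}{\log(1/\theta)}\right\rceil.$$ If $\mathfrak F_{\mathcal S}$ is a singleton, $\mathfrak F_{\mathcal S}=\{F_{\mathcal S}\}$, then $$F(y^k)=F(\bar y^{k+1})=F_{\mathcal S}\qquad\text{for all }k\ge K_{\rm id},$$ and moreover there exists $\vartheta_{\mathcal S}\in\{-1,1\}^n$ such that $$\vartheta(y^k)=\vartheta(\bar y^{k+1})=\vartheta_{\mathcal S}\qquad\text{for all }k\ge K_{\rm id}.$$
   Context: Norms are Euclidean (vectors) and spectral (matrices); inequalities are componentwise and $\odot$ is the componentwise product. Let $P,Q\in\mathbb R^{m\times n}$, $c\in\mathbb R^m$, and $\mathcal C:=\{(u,v)\in\mathbb R^n\times\mathbb R^n: u\ge0,\ v\ge0,\ u\odot v=0\}$. For $y=(u,v)\in\mathbb R^{2n}$ set $H:=[P,\ Q]$, $\Phi(y):=\tfrac12\|Hy-c\|^2=\tfrac12\|Pu+Qv-c\|^2$, so $\nabla\Phi(y)=H^\top(Hy-c)$, and $L:=\|H\|^2$ (with $L>0$). Let $\mathcal S:=\{y\in\mathcal C: Hy=c\}$. For a nonempty closed set $\Omega$, $\Pi_\Omega(y):=\operatorname{argmin}_{z\in\Omega}\|y-z\|$ (possibly set-valued), $\operatorname{dist}(y,\Omega):=\inf_{z\in\Omega}\|y-z\|$, and $\operatorname{dist}(\Omega_1,\Omega_2):=\inf\{\|z_1-z_2\|:z_1\in\Omega_1,z_2\in\Omega_2\}$.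 For $\alpha>0$ and $y\in\mathcal C$, $\mathcal G_\alpha(y):=\{\alpha^{-1}(y-\widehat y):\widehat y\in\Pi_{\mathcal C}(y-\alpha\nabla\Phi(y))\}$ and $g_\alpha(y):=\operatorname{dist}(0,\mathcal G_\alpha(y))$. The descent constant is $c_d:=\frac1{2\overline\alpha}-\frac L2>0$. (Constants $\kappa_r$ and $\kappa_G$ with the required properties exist under the stated hypotheses.) Faces. For $s\in\{-1,1\}^n$, $F_s:=\{(\widetilde u,\widetilde v)\in\mathcal C:\widetilde v_i=0\text{ if }s_i=1,\ \widetilde u_i=0\text{ if }s_i=-1\}$, and $\mathfrak F:=\{F_s:s\in\{-1,1\}^n\}$. For $y=(u,v)\in\mathcal C$, $\vartheta_i(y):=\operatorname{sgn}(u_i-v_i)\in\{-1,0,1\}$; $\chi_i(y):=1$ if $u_i>0$ or $u_i=v_i=0$, and $\chi_i(y):=-1$ if $v_i>0$; and $F(y):=F_{\chi(y)}$. Define $\mathfrak F_{\mathcal S}:=\{F\in\mathfrak F:F\cap\mathcal S\ne\varnothing\}$ and $\gamma_{\mathcal S}:=\min_{F\in\mathfrak F\setminus\mathfrak F_{\mathcal S}}\operatorname{dist}(F,\mathcal S)$ if $\mathfrak F\setminus\mathfrak F_{\mathcal S}\ne\varnothing$, and $\gamma_{\mathcal S}:=+\infty$ if $\mathfrak F_{\mathcal S}=\mathfrak F$. (Under the stated hypotheses $\mathcal S$ is compact and $\gamma_{\mathcal S}>0$.) Safeguarded projected-gradient algorithm. Given $y^0\in\mathcal C$, an integer $q\ge1$,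 $\tau\ge0$, set $\nu_0=0$ and $s_c:=\max\{1,\|c\|\}$. At iteration $k=0,1,2,\dots$: choose a stepsize $\alpha_k>0$; choose $\bar y^{k+1}\in\Pi_{\mathcal C}(y^k-\alpha_k\nabla\Phi(y^k))$; set $\nu_{k+1}:=\nu_k+1$ if $\vartheta(\bar y^{k+1})=\vartheta(y^k)$ and $\nu_{k+1}:=0$ otherwise. The trigger $\mathcal T_k$ holds if and only if $\|H\bar y^{k+1}-c\|/s_c\le\tau$ or $\nu_{k+1}\ge q$. If $\mathcal T_k$ holds, a refinement candidate $\widehat y^{k+1}$ is computed by some rule (left open; the rule may fail to produce a candidate). If a candidate is produced and $\widehat y^{k+1}\in\mathcal C$ and $\Phi(\widehat y^{k+1})\le\Phi(\bar y^{k+1})$, set $y^{k+1}:=\widehat y^{k+1}$; in all other cases set $y^{k+1}:=\bar y^{k+1}$. *)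

(* Defs.v *)
From HB Require Import structures.
From mathcomp Require Import all_boot all_order all_algebra.
From mathcomp Require Import all_classical all_reals all_analysis.
From mathcomp Require Import ring.

Set Implicit Arguments.
Unset Strict Implicit.
Unset Printing Implicit Defensive.

Import Order.TTheory GRing.Theory Num.Theory.
Import numFieldNormedType.Exports.

Local Open Scope classical_set_scope.
Local Open Scope ring_scope.

Section Euclidean.
Context {R : realType}.

(* The library norm on matrices is the sup norm, hence the following two
   definitions for the Euclidean norm and the spectral norm it induces. *)
Definition enorm (k : nat) (x : 'cV[R]_k) : R :=
  Num.sqrt (\sum_i x i 0 ^+ 2).

Definition spectral_norm (m k : nat) (A : 'M[R]_(m, k)) : R :=
  sup [set enorm (A *m x) | x in [set x : 'cV[R]_k | enorm x <= 1]].

Definition proj (k : nat) (Omega : set 'cV[R]_k) (y : 'cV[R]_k) :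
    set 'cV[R]_k :=
  [set z | Omega z /\ forall w, Omega w -> enorm (y - z) <= enorm (y - w)].

(* These are real-valued infima, so they have the usual meaning only for
   nonempty sets. *)
Definition dist (k : nat) (y : 'cV[R]_k) (Omega : set 'cV[R]_k) : R :=
  inf [set enorm (y - z) | z in Omega].

Definition set_dist (k : nat) (Omega1 Omega2 : set 'cV[R]_k) : R :=
  inf [set enorm (z1 - z2) | z1 in Omega1 & z2 in Omega2].

Definition gradient (k : nat) (f : 'cV[R]_k -> R) (y : 'cV[R]_k) : 'cV[R]_k :=
  \col_j 'D_(delta_mx j 0) (f : 'cV[R]_k -> R^o) y.

End Euclidean.

Section Complementarity.
Context {R : realType} {n : nat}.
Implicit Types (y : 'cV[R]_(n + n)) (s : 'cV[int]_n).

(* A point y = (u, v) of R^(2n) is the column block matrix with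
   u = usubmx y and v = dsubmx y. *)
Definition compl_set : set 'cV[R]_(n + n) :=
  [set y | [/\ forall i, 0 <= usubmx y i 0,
               forall i, 0 <= dsubmx y i 0 &
               forall i, usubmx y i 0 * dsubmx y i 0 = 0]].

Definition sign_vectors : set 'cV[int]_n :=
  [set s | forall i, s i 0 = 1 \/ s i 0 = -1].

Definition face s : set 'cV[R]_(n + n) :=
  [set y | compl_set y /\
     forall i, (s i 0 = 1 -> dsubmx y i 0 = 0) /\
               (s i 0 = -1 -> usubmx y i 0 = 0)].

Definition faces : set (set 'cV[R]_(n + n)) := face @` sign_vectors.

Definition vartheta y : 'cV[int]_n :=
  \col_i sgz (usubmx y i 0 - dsubmx y i 0).

(* On compl_set the else branch is exactly the case v_i > 0. *)
Definition chi y : 'cV[int]_n :=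
  \col_i (if (0 < usubmx y i 0) || ((usubmx y i 0 == 0) && (dsubmx y i 0 == 0))
          then 1 else -1).

Definition face_of y : set 'cV[R]_(n + n) := face (chi y).

Definition faces_meeting (S : set 'cV[R]_(n + n)) :
    set (set 'cV[R]_(n + n)) :=
  [set F | faces F /\ F `&` S !=set0].

(* There are finitely many faces, so this infimum is a minimum, unless every
   face meets S, in which case ereal_inf set0 = +oo. *)
Definition face_gap (S : set 'cV[R]_(n + n)) : \bar R :=
  ereal_inf [set (set_dist F S)%:E | F in faces `\` faces_meeting S].

End Complementarity.

Section Algorithm.
Context {R : realType} {m n : nat}.
Variables (H : 'M[R]_(m, n + n)) (c : 'cV[R]_m).
Implicit Types (y z : 'cV[R]_(n + n)) (a : R).

Definition Phi y : R := 2^-1 * enorm (H *m y - c) ^+ 2.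

Definition solutions : set 'cV[R]_(n + n) :=
  [set y | compl_set y /\ H *m y = c].

Definition level_set y0 : set 'cV[R]_(n + n) :=
  [set y | compl_set y /\ Phi y <= Phi y0].

Definition pg_step a y : set 'cV[R]_(n + n) :=
  proj compl_set (y - a *: gradient Phi y).

Definition grad_mapping a y : set 'cV[R]_(n + n) :=
  [set a^-1 *: (y - z) | z in pg_step a y].

Definition grad_residual a y : R := dist 0 (grad_mapping a y).

(* The sequence nu_k; ybar k.+1 is the projected point computed at iteration
   k, and ybar 0 plays no role. *)
Fixpoint stall_count (y ybar : nat -> 'cV[R]_(n + n)) (k : nat) : nat :=
  if k is j.+1 then
    if vartheta (ybar j.+1) == vartheta (y j)
    then (stall_count y ybar j).+1 else 0%N
  else 0%N.

Definition trigger (q : nat) (tau : R) (y ybar : nat -> 'cV[R]_(n + n))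
    (k : nat) : bool :=
  (enorm (H *m ybar k.+1 - c) / Num.max 1 (enorm c) <= tau)
  || (q <= stall_count y ybar k.+1)%N.

(* The refinement rule is arbitrary: cand k.+1 is its outcome at iteration k
   (None when no candidate is produced), which is only consulted when the
   trigger holds. *)
Record safeguarded_pg (q : nat) (tau : R) (alpha : nat -> R)
    (y ybar : nat -> 'cV[R]_(n + n))
    (cand : nat -> option 'cV[R]_(n + n)) : Prop := SafeguardedPG {
  spg_init : compl_set (y 0%N);
  spg_alpha : forall k, 0 < alpha k;
  spg_step : forall k, pg_step (alpha k) (y k) (ybar k.+1);
  spg_accept : forall k z, trigger q tau y ybar k -> cand k.+1 = Some z ->
    compl_set z -> Phi z <= Phi (ybar k.+1) -> y k.+1 = z;
  spg_reject : forall k,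
    ~ (trigger q tau y ybar k /\
       exists z, [/\ cand k.+1 = Some z, compl_set z &
                     Phi z <= Phi (ybar k.+1)]) ->
    y k.+1 = ybar k.+1 }.

Lemma gradient_Phi y : gradient Phi y = H^T *m (H *m y - c).
Proof.
apply/matrixP => j j'; rewrite ord1 !mxE {j'}.
set e := delta_mx j 0; set r := H *m y - c; set w := H *m e.
have PhiE (h : R) : Phi (h *: e + y) =
    Phi y + h * (\sum_i r i 0 * w i 0) + h ^+ 2 * (2^-1 * \sum_i w i 0 ^+ 2).
  have sq_ge0 (x : 'cV[R]_m) : 0 <= \sum_i x i 0 ^+ 2.
    by apply: sumr_ge0 => i _; exact: sqr_ge0.
  rewrite /Phi /enorm !sqr_sqrtr //.
  have -> : H *m (h *: e + y) - c = r + h *: w.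
    by rewrite mulmxDr -scalemxAr addrAC addrC -addrA (addrC (- c)).
  have -> : \sum_i (r + h *: w) i 0 ^+ 2 =
      \sum_i r i 0 ^+ 2 + (h * (\sum_i r i 0 * w i 0)) *+ 2
      + h ^+ 2 * \sum_i w i 0 ^+ 2.
    rewrite !mulr_sumr -sumrMnl -!big_split /=; apply: eq_bigr => i _.
    by rewrite !mxE sqrrD exprMn mulrCA.
  set A := \sum_i r i 0 ^+ 2; set B := h * _; set D := \sum_i w i 0 ^+ 2.
  by move: A B D => A B D; field.
rewrite /derive.
have -> : \sum_k H^T j k * r k 0 = \sum_i r i 0 * w i 0.
  apply: eq_bigr => i _; rewrite mulrC; congr (_ * _).
  rewrite !mxE (bigD1 j) //= !mxE !eqxx mulr1 big1 ?addr0 // => k kj.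
  by rewrite !mxE (negbTE kj) mulr0.
set b := \sum_i r i 0 * w i 0; set q := 2^-1 * \sum_i w i 0 ^+ 2.
have cvgq : (fun h : R => b + h * q) @ 0^' --> b.
  rewrite -[X in _ --> X]addr0 -[X in _ --> b + X](mul0r q).
  apply: cvg_within_filter.
  by apply: cvgD; [exact: cvg_cst | apply: cvgMl; exact: cvg_id].
apply/cvg_lim => //.
apply: cvg_trans cvgq; apply: near_eq_cvg.
near=> h.
have h0 : h != 0 by near: h; exact: nbhs_dnbhs_neq.
have dPhi : Phi (h *: e + y) - Phi y = h * (b + h * q).
  by rewrite PhiE -/b -/q; ring.
rewrite -[RHS]/(h^-1 * (Phi (h *: e + y) - Phi y)).
by rewrite dPhi mulKf.
Unshelve. all: by end_near.
Qed.

End Algorithm.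

(* K is the identification index: if gap < +oo, the smallest natural number
   with C0 * theta^(K/2) < gap; otherwise 0. *)
Definition is_ident_index {R : realType} (C0 theta : R) (gap : \bar R)
    (K : nat) : Prop :=
  let below (k : nat) := ((C0 * theta `^ (k%:R / 2))%:E < gap)%E in
  ((gap < +oo)%E -> below K /\ forall k, below k -> (K <= k)%N) /\
  (gap = +oo%E -> K = 0%N).

(* Main.v *)
Require Import Defs.
From HB Require Import structures.
From mathcomp Require Import all_boot all_order all_algebra.
From mathcomp Require Import all_classical all_reals all_analysis.
From mathcomp Require Import ring lra.

(** The proof combines a linear rate for the objective with a geometric gap
    between the solution set S and the faces that miss it.

    Rate.  Comparing the projected point with y itself in the definition of
    the projection gives, since alpha < 1/L, the descent
    Phi ybar <= Phi y - cd * |y - ybar|^2 ([sufficient_decrease]).  The length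
    of the step is at least alpha times the gradient residual, hence by the
    error bound at least (alo / kG) * dist y S, while Phi y is at most
    (L/2) * (dist y S)^2 because H maps S to c.  So one step multiplies Phi by
    at most theta ([Phi_contraction]).  A refinement is accepted only if it
    does not increase Phi, so it cannot spoil the rate
    ([iterate_linear_decay]), and the residual error bound turns the decay of
    Phi into dist y_k S <= C0 * theta^(k/2) ([dist_solutions_decay]).

    Gap.  A face that misses S is at positive distance from S: faces are
    closed and S is bounded, so a truncation of the face is compact and the
    residual |H y - c| is bounded away from 0 on it
    ([set_dist_solutions_gt0]).  As there are finitely many faces, the gap is
    positive ([face_gap_gt0]), and the index Kid exists; taking logarithms
    gives its explicit bound ([is_ident_index_exists]).

    Identification.  From Kid on, the iterates are closer to S than the gap,
    so every face through them, not only the one singled out by chi, meets S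
    ([near_face_meets]).  This strong form settles the last claim: if a point
    had u_i = v_i = 0, it would lie on two distinct faces, both meeting S,
    against the uniqueness of such a face; so no sign of u - v vanishes and
    the sign pattern is the one that names the face
    ([vartheta_identified]). *)

Set Implicit Arguments.
Unset Strict Implicit.
Unset Printing Implicit Defensive.

Import Order.TTheory GRing.Theory Num.Theory.
Import numFieldNormedType.Exports.

Local Open Scope classical_set_scope.
Local Open Scope ring_scope.

(** * Euclidean and spectral norms, distances *)

Section EuclideanGeometry.
Context {R : realType}.

Definition inner k (x y : 'cV[R]_k) : R := (x^T *m y) 0 0.

Lemma innerE k (x y : 'cV[R]_k) : inner x y = \sum_i x i 0 * y i 0.
Proof. by rewrite /inner mxE; apply: eq_bigr => i _; rewrite mxE. Qed.

Lemma innerC k (x y : 'cV[R]_k) : inner x y = inner y x.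
Proof. by rewrite !innerE; apply: eq_bigr => i _; rewrite mulrC. Qed.

Lemma innerDr k (x y z : 'cV[R]_k) : inner x (y + z) = inner x y + inner x z.
Proof. by rewrite /inner mulmxDr mxE. Qed.

Lemma innerZr k a (x y : 'cV[R]_k) : inner x (a *: y) = a * inner x y.
Proof. by rewrite /inner -scalemxAr mxE. Qed.

Lemma inner_trmxl m k (A : 'M[R]_(m, k)) x y :
  inner (A^T *m x) y = inner x (A *m y).
Proof. by rewrite /inner trmx_mul trmxK mulmxA. Qed.

Lemma enorm_ge0 k (x : 'cV[R]_k) : 0 <= enorm x.
Proof. exact: sqrtr_ge0. Qed.

Lemma enorm_sqr k (x : 'cV[R]_k) : enorm x ^+ 2 = inner x x.
Proof.
rewrite innerE /enorm sqr_sqrtr; last by apply: sumr_ge0 => i _; exact: sqr_ge0.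
by apply: eq_bigr => i _; rewrite expr2.
Qed.

Lemma enorm_sqrD k (x y : 'cV[R]_k) :
  enorm (x + y) ^+ 2 = enorm x ^+ 2 + 2 * inner x y + enorm y ^+ 2.
Proof.
rewrite !enorm_sqr innerDr !(innerC (x + y)) !innerDr (innerC y x).
by ring.
Qed.

Lemma enormZ k a (x : 'cV[R]_k) : enorm (a *: x) = `|a| * enorm x.
Proof.
apply/eqP; rewrite -(eqrXn2 (ltn0Sn 1)) ?mulr_ge0 ?enorm_ge0//.
by rewrite exprMn !enorm_sqr innerZr innerC innerZr mulrA real_normK ?num_real.
Qed.

Lemma enormN k (x : 'cV[R]_k) : enorm (- x) = enorm x.
Proof. by rewrite -scaleN1r enormZ normrN1 mul1r. Qed.

Lemma coord_le_enorm k (x : 'cV[R]_k) i : `|x i 0| <= enorm x.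
Proof.
rewrite -sqrtr_sqr /enorm ler_sqrt; last first.
  by apply: sumr_ge0 => j _; exact: sqr_ge0.
rewrite (bigD1 i) //= lerDl.
by apply: sumr_ge0 => j _; exact: sqr_ge0.
Qed.

Lemma enorm_eq0 k (x : 'cV[R]_k) : enorm x = 0 -> x = 0.
Proof.
move=> x0; apply/matrixP => i j; rewrite ord1 mxE; apply/eqP.
by rewrite -normr_le0 -x0 coord_le_enorm.
Qed.

Lemma enorm0 k : enorm (0 : 'cV[R]_k) = 0.
Proof. by rewrite -(scale0r 0) enormZ normr0 mul0r. Qed.

(** A real supremum is only meaningful for a bounded set; bounding each
    coordinate of x by 1 is a crude but sufficient way to bound A *m x. *)
Lemma spectral_norm_has_ubound m k (A : 'M[R]_(m, k)) :
  has_ubound [set enorm (A *m x) | x in [set x : 'cV[R]_k | enorm x <= 1]].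
Proof.
exists (Num.sqrt (\sum_i (\sum_j `|A i j|) ^+ 2)) => _ [x /= x1 <-].
rewrite /enorm ler_sqrt; last by apply: sumr_ge0 => i _; exact: sqr_ge0.
apply: ler_sum => i _.
rewrite -(real_normK (num_real ((A *m x) i 0))) ler_sqr ?nnegrE//; last first.
  by apply: sumr_ge0.
rewrite mxE (le_trans (ler_norm_sum _ _ _))//; apply: ler_sum => j _.
by rewrite normrM ler_piMr// (le_trans (coord_le_enorm x j)).
Qed.

Lemma enorm_mulmx_le m k (A : 'M[R]_(m, k)) x :
  enorm (A *m x) <= spectral_norm A * enorm x.
Proof.
have [x0|x0] := eqVneq (enorm x) 0.
  by rewrite (enorm_eq0 x0) mulmx0 !enorm0 mulr0.
have xgt0 : 0 < enorm x by rewrite lt_neqAle eq_sym x0 enorm_ge0.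
rewrite -ler_pdivrMr//.
apply: (ub_le_sup (spectral_norm_has_ubound A)).
exists ((enorm x)^-1 *: x) => /=.
  by rewrite enormZ ger0_norm ?invr_ge0 ?enorm_ge0// mulVf.
by rewrite -scalemxAr enormZ ger0_norm ?invr_ge0 ?enorm_ge0// mulrC.
Qed.

Lemma spectral_norm_ge0 m k (A : 'M[R]_(m, k)) : 0 <= spectral_norm A.
Proof.
apply: (ub_le_sup (spectral_norm_has_ubound A)); exists 0 => /=.
  by rewrite enorm0.
by rewrite mulmx0 enorm0.
Qed.

Lemma dist_le k (x z : 'cV[R]_k) (Omega : set 'cV[R]_k) :
  Omega z -> dist x Omega <= enorm (x - z).
Proof.
move=> Oz; apply: ge_inf; last by exists z.
by exists 0 => _ [w _ <-]; exact: enorm_ge0.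
Qed.

Lemma le_dist k (x : 'cV[R]_k) (Omega : set 'cV[R]_k) e : Omega !=set0 ->
  (forall z, Omega z -> e <= enorm (x - z)) -> e <= dist x Omega.
Proof.
move=> [z Oz] lbe; apply: lb_le_inf; first by exists (enorm (x - z)), z.
by move=> _ [w Ow <-]; exact: lbe.
Qed.

Lemma dist_ge0 k (x : 'cV[R]_k) (Omega : set 'cV[R]_k) :
  Omega !=set0 -> 0 <= dist x Omega.
Proof. by move=> O0; apply: le_dist => // z _; exact: enorm_ge0. Qed.

Lemma set_dist_le_dist k (Omega1 Omega2 : set 'cV[R]_k) x :
  Omega1 x -> Omega2 !=set0 -> set_dist Omega1 Omega2 <= dist x Omega2.
Proof.
move=> O1x O2; apply: le_dist => // z O2z; apply: ge_inf; last first.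
  by exists x => //; exists z.
by exists 0 => _ [w _ [w' _ <-]]; exact: enorm_ge0.
Qed.

End EuclideanGeometry.

(** * One projected gradient step *)

Section ProjectedGradientStep.
Context {R : realType} {m n : nat}.
Variables (H : 'M[R]_(m, n + n)) (c : 'cV[R]_m).
Implicit Types (y z d : 'cV[R]_(n + n)) (a : R).

Local Notation Phi := (Phi H c).
Local Notation S := (solutions H c).
Local Notation L := (spectral_norm H ^+ 2).

Lemma Phi_ge0 y : 0 <= Phi y.
Proof. by rewrite /Defs.Phi mulr_ge0 ?invr_ge0 ?sqr_ge0. Qed.

Lemma residual_sqrt_Phi y : enorm (H *m y - c) = Num.sqrt (2 * Phi y).
Proof.
rewrite /Defs.Phi mulrA divff ?pnatr_eq0// mul1r.
by rewrite sqrtr_sqr ger0_norm ?enorm_ge0.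
Qed.

Lemma PhiD y d : Phi (y + d) =
  Phi y + inner (gradient Phi y) d + 2^-1 * enorm (H *m d) ^+ 2.
Proof.
rewrite gradient_Phi inner_trmxl /Defs.Phi mulmxDr addrAC enorm_sqrD.
by field.
Qed.

(** Being at least as close to y - a * grad as y is, the projected point z
    satisfies 2 <grad, z - y> <= - |z - y|^2 / a; the second-order term of the
    quadratic Phi costs at most (L/2) |z - y|^2. *)
Lemma sufficient_decrease a y z : compl_set y -> 0 < a -> pg_step H c a y z ->
  Phi z <= Phi y - ((2 * a)^-1 - L / 2) * enorm (y - z) ^+ 2.
Proof.
move=> Cy a0 [_ /(_ y Cy)].
set g := gradient _ y; set d := z - y => closer.
have -> : z = y + d by rewrite /d addrC subrK.
have <- : enorm d = enorm (y - (y + d)).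
  by rewrite opprD addNKr enormN.
rewrite PhiD -/g.
have desc : 2 * inner g d <= - a^-1 * enorm d ^+ 2.
  have : enorm (d + a *: g) ^+ 2 <= enorm (a *: g) ^+ 2.
    rewrite ler_sqr ?nnegrE ?enorm_ge0//.
    have <- : enorm (y - a *: g - y) = enorm (a *: g).
      by rewrite addrAC subrr add0r enormN.
    suff <- : enorm (y - a *: g - z) = enorm (d + a *: g) by [].
    rewrite -enormN; congr enorm.
    by rewrite /d !opprB addrA addrAC.
  rewrite enorm_sqrD innerZr innerC gerDr => le0.
  rewrite -(ler_pM2l a0) mulNr mulrN mulVKf ?gt_eqF//.
  lra.
have curv : enorm (H *m d) ^+ 2 <= L * enorm d ^+ 2.
  by rewrite -exprMn ler_sqr ?nnegrE ?mulr_ge0 ?enorm_ge0 ?spectral_norm_ge0//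
    enorm_mulmx_le.
rewrite invfM.
move: desc curv; set A := enorm d ^+ 2; set B := enorm (H *m d) ^+ 2.
set G := inner g d; set N := spectral_norm H ^+ 2; move: (Phi y) => p.
clearbody A B G N; move: (a^-1) => b h1 h2.
have -> : (2^-1 * b - N / 2) * A = 2^-1 * (b * A) - 2^-1 * (N * A) by ring.
move: h1 h2; rewrite mulNr; move: (b * A) (N * A) => X Y.
lra.
Qed.

Lemma grad_residual_le a y z : 0 < a -> pg_step H c a y z ->
  a * grad_residual H c a y <= enorm (y - z).
Proof.
move=> a0 step; rewrite -ler_pdivlMl//.
have := @dist_le _ _ 0 (a^-1 *: (y - z)) (grad_mapping H c a y).
rewrite sub0r enormN enormZ gtr0_norm ?invr_gt0//; apply.
by exists z.
Qed.

Lemma grad_residual_ge0 a y z : pg_step H c a y z -> 0 <= grad_residual H c a y.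
Proof. by move=> step; apply: dist_ge0; exists (a^-1 *: (y - z)), z. Qed.

(** A converse to the residual error bound, from H *m y - c = H *m (y - z) for
    every solution z. *)
Lemma Phi_le_dist y : S !=set0 -> Phi y <= L / 2 * dist y S ^+ 2.
Proof.
move=> S0.
suff res : enorm (H *m y - c) <= spectral_norm H * dist y S.
  rewrite /Defs.Phi (mulrC L) -mulrA ler_pM2l ?invr_gt0// -exprMn.
  by rewrite ler_sqr ?nnegrE ?mulr_ge0 ?enorm_ge0 ?dist_ge0 ?spectral_norm_ge0.
have bnd z : S z -> enorm (H *m y - c) <= spectral_norm H * enorm (y - z).
  by move=> [_ <-]; rewrite -mulmxBr enorm_mulmx_le.
have [H0|H0] := eqVneq (spectral_norm H) 0.
  by have [z Sz] := S0; move: (bnd z Sz); rewrite H0 !mul0r.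
have Hgt0 : 0 < spectral_norm H.
  by rewrite lt_neqAle eq_sym H0 spectral_norm_ge0.
rewrite -ler_pdivrMl//; apply: le_dist => // z Sz.
by rewrite ler_pdivrMl// bnd.
Qed.

(** The descent cd * |y - z|^2 is a fixed fraction of Phi y:
    alo * dist y S <= kG * |y - z| by the error bound, and
    Phi y <= (L/2) * (dist y S)^2. *)
Lemma Phi_contraction a alo ahi kG y z :
  S !=set0 -> 0 < L -> compl_set y -> pg_step H c a y z ->
  0 < alo -> alo <= a <= ahi -> ahi < L^-1 -> 0 < kG ->
  dist y S <= kG * grad_residual H c a y ->
  Phi z <=
    (1 - 2 * ((2 * ahi)^-1 - L / 2) * alo ^+ 2 / (L * kG ^+ 2)) * Phi y.
Proof.
move=> S0 Lgt0 Cy step alo0 /andP[aloa aahi] ahiL kG0 eb.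
have a0 : 0 < a := lt_le_trans alo0 aloa.
have ahi0 : 0 < ahi := lt_le_trans a0 aahi.
set cd := (2 * ahi)^-1 - L / 2.
have cd0 : 0 <= cd.
  have Lahi : L <= ahi^-1 by rewrite -(invrK L) lef_pV2 ?posrE ?invr_gt0// ltW.
  by rewrite /cd invfM; move: Lahi; set l := L; lra.
have cda : cd <= (2 * a)^-1 - L / 2.
  by rewrite /cd lerB// lef_pV2 ?posrE ?mulr_gt0// ler_pM2l.
set g := grad_residual H c a y in eb.
have g0 : 0 <= g by exact: grad_residual_ge0 step.
have short : alo ^+ 2 * dist y S ^+ 2 <= kG ^+ 2 * enorm (y - z) ^+ 2.
  rewrite -!exprMn ler_sqr ?nnegrE ?mulr_ge0 ?dist_ge0 ?enorm_ge0 ?(ltW alo0)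
    ?(ltW kG0)//.
  apply: le_trans (_ : kG * (a * g) <= _); last first.
    by rewrite ler_pM2l// grad_residual_le.
  rewrite mulrCA; apply: ler_pM => //; rewrite ?dist_ge0 ?(ltW alo0)//.
apply: le_trans (sufficient_decrease Cy a0 step) _.
rewrite [leRHS]mulrBl mul1r lerD2l lerN2.
apply: le_trans (_ : cd * enorm (y - z) ^+ 2 <= _); last first.
  by rewrite ler_wpM2r ?sqr_ge0.
have kG2 : 0 < kG ^+ 2 by rewrite exprn_gt0.
have -> : 2 * cd * alo ^+ 2 / (L * kG ^+ 2) * Phi y =
    cd * (alo ^+ 2 * (2 / L * Phi y) / kG ^+ 2).
  by rewrite invfM; ring.
rewrite ler_wpM2l// ler_pdivrMr// (mulrC (enorm _ ^+ 2)).
apply: le_trans short; rewrite ler_wpM2l ?sqr_ge0//.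
rewrite -ler_pdivlMl ?divr_gt0// invf_div.
exact: Phi_le_dist.
Qed.

End ProjectedGradientStep.

(** * Compactness and continuity for column vectors *)

Section Compactness.
Context {R : realType}.

Lemma trmx_continuous m k : continuous (@trmx R m k).
Proof.
move=> /= x s /(nbhs_ballP x^T) [e e0 es].
apply/nbhs_ballP; exists e => //= z [_ xz]; apply: es; split=> // i j.
by rewrite !mxE; exact: xz.
Qed.

Lemma closed_preim_coord k (i : 'I_k) (D : set R) :
  closed D -> closed [set z : 'cV[R]_k | D (z i 0)].
Proof. by move: D; apply/continuous_closedP; exact: coord_continuous. Qed.

(** Row vectors with entries in a segment form a compact set by Tychonoff's
    theorem, and transposition carries this to columns. *)
Lemma compact_cV k (M : R) (K : set 'cV[R]_k) :
  closed K -> (forall z i, K z -> `|z i 0| <= M) -> compact K.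
Proof.
move=> Kcl KM.
pose B : set 'rV[R]_k := [set w | forall i, w 0 i \in `[- M, M]].
have Bc : compact B.
  apply: (@rV_compact _ _ (fun=> `[- M, M]%classic)) => i.
  exact: segment_compact.
have BTc : compact ((@trmx R 1 k) @` B).
  apply: continuous_compact Bc; apply: continuous_subspaceT.
  exact: trmx_continuous.
apply: (subclosed_compact Kcl BTc) => z Kz; exists z^T; last by rewrite trmxK.
by move=> i; rewrite mxE in_itv/= -ler_norml KM.
Qed.

Lemma Phi_continuous m n (H : 'M[R]_(m, n + n)) c : continuous (Phi H c).
Proof.
have -> : Phi H c = fun z =>
    2^-1 * \sum_i (\sum_j H i j * z j 0 - c i 0) ^+ 2.
  apply/funext => z; rewrite /Phi enorm_sqr innerE; congr (_ * _).
  by apply: eq_bigr => i _; rewrite !mxE expr2.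
have affine i : continuous
    (fun z : 'cV[R]_(n + n) => \sum_j H i j * z j 0 - c i 0 : R).
  move=> z; apply: continuousB; last exact: cst_continuous.
  move: z; apply: (continuous_big (@add_continuous R^o)) => j _ z.
  apply: (@continuousM _ _ (fun=> H i j) (fun z : 'cV[R]_(n + n) => z j 0)).
    exact: cst_continuous.
  exact: coord_continuous.
pose g (z : 'cV[R]_(n + n)) : R := \sum_i (\sum_j H i j * z j 0 - c i 0) ^+ 2.
have gc : continuous g.
  apply: (continuous_big (@add_continuous R^o)) => i _ z.
  exact: (continuousM (affine i z) (affine i z)).
by move=> z; exact: (continuousM (@cst_continuous _ _ (2^-1 : R) z) (gc z)).
Qed.

End Compactness.

(** * Faces of the complementarity set *)

Section Faces.
Context {R : realType} {n : nat}.
Implicit Types (y z : 'cV[R]_(n + n)) (s : 'cV[int]_n) (S : set 'cV[R]_(n + n)).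

Lemma face0 s : face s (0 : 'cV[R]_(n + n)).
Proof.
by split=> [|i]; [split=> i|]; rewrite !mxE ?mulr0.
Qed.

Lemma closed_face s : closed (@face R n s).
Proof.
pose C i := [set z : 'cV[R]_(n + n) | [/\ 0 <= z (lshift n i) 0,
  0 <= z (rshift n i) 0, z (lshift n i) 0 * z (rshift n i) 0 = 0,
  s i 0 = 1 -> z (rshift n i) 0 = 0 & s i 0 = -1 -> z (lshift n i) 0 = 0]].
have -> : face s = \bigcap_i C i.
  apply/seteqP; split=> z /=.
    move=> [[u0 v0 uv] sz] i _; have [s1 sN1] := sz i.
    by move: (u0 i) (v0 i) (uv i) s1 sN1; rewrite !mxE; split.
  move=> Cz; split; first split.
  - by move=> i; rewrite mxE; case: (Cz i I).
  - by move=> i; rewrite mxE; case: (Cz i I).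
  - by move=> i; rewrite !mxE; case: (Cz i I).
  - by move=> i; rewrite !mxE; case: (Cz i I).
apply: closed_bigI => i _.
have closed_impl (P : Prop) (D : set 'cV[R]_(n + n)) :
    closed D -> closed [set z | P -> D z].
  move=> Dcl; have [p|np] := pselect P.
    by rewrite (_ : [set z | _] = D)//; apply/seteqP; split=> z //= /(_ p).
  rewrite (_ : [set z | _] = setT); first exact: closedT.
  by apply/seteqP; split=> z //= _ /np.
pose u z : R := z (lshift n i) 0; pose v z : R := z (rshift n i) 0.
rewrite (_ : C i = [set z | 0 <= u z] `&` [set z | 0 <= v z] `&`
    [set z | u z * v z = 0] `&` [set z | s i 0 = 1 -> v z = 0] `&`
    [set z | s i 0 = -1 -> u z = 0]); last first.
  by apply/seteqP; split=> z /=; [case=> ? ? ? ? ?|case=> [[[[]]]]].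
have vcl : closed [set z | v z = 0].
  exact: (@closed_preim_coord _ _ (rshift n i) _ (@closed_eq _ _)).
have ucl : closed [set z | u z = 0].
  exact: (@closed_preim_coord _ _ (lshift n i) _ (@closed_eq _ _)).
apply: closedI; last exact: closed_impl ucl.
apply: closedI; last exact: closed_impl vcl.
apply: closedI; first apply: closedI.
- exact: (@closed_preim_coord _ _ (lshift n i) _ (@closed_ge _ _)).
- exact: (@closed_preim_coord _ _ (rshift n i) _ (@closed_ge _ _)).
- apply: (@preimage_closed _ _ (fun z => u z * v z) [set x | x = 0]).
    move=> z _; exact: (continuousM
      (@coord_continuous R _ _ (lshift n i) 0 z)
      (@coord_continuous R _ _ (rshift n i) 0 z)).
  exact: closed_eq.
Qed.

(** The point with u_i = 1 where s_i = 1 and v_i = 1 where s_i = -1 lies on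
    the face of s and on no other. *)
Lemma face_inj s s' : sign_vectors s -> sign_vectors s' ->
  @face R n s = face s' -> s = s'.
Proof.
move=> Ss Ss' ss'.
pose w : 'cV[R]_(n + n) :=
  col_mx (\col_i (s i 0 == 1)%:R) (\col_i (s i 0 == -1)%:R).
have [_ ws'] : face s' w.
  rewrite -ss'; split; first split.
  - by move=> i; rewrite col_mxKu mxE ler0n.
  - by move=> i; rewrite col_mxKd mxE ler0n.
  - by move=> i; rewrite col_mxKu col_mxKd !mxE; case: (Ss i) => ->;
      rewrite ?mul0r ?mulr0.
  - by move=> i; rewrite col_mxKu col_mxKd !mxE; split=> ->.
apply/matrixP => i j; rewrite (ord1 j); have [w1 wN1] := ws' i.
move: w1 wN1; rewrite col_mxKu col_mxKd !mxE.
case: (Ss i) => ->; case: (Ss' i) => -> //=.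
- by move=> _ /(_ erefl)/eqP; rewrite oner_eq0.
- by move=> /(_ erefl)/eqP; rewrite oner_eq0.
Qed.

Lemma sign_vectors_chi y : sign_vectors (chi y).
Proof. by move=> i; rewrite mxE; case: ifP; [left|right]. Qed.

Lemma mem_face_of y : compl_set y -> face_of y y.
Proof.
move=> Cy; split=> // i; have [u0 v0 uv] := Cy.
rewrite mxE; case: ifPn => [/orP[u_gt0|/andP[_ /eqP]]|u_le0]; split=> //.
- by move=> _; apply/eqP; move/eqP: (uv i); rewrite mulf_eq0 gt_eqF.
- by move: u_le0; rewrite negb_or lt_neqAle u0 andbT negbK => /andP[/eqP <-].
Qed.

(** A face that misses S is at distance at least the gap from S, and at most
    dist y S when it contains y. *)
Lemma near_face_meets S s y : S !=set0 -> sign_vectors s -> face s y ->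
  ((dist y S)%:E < face_gap S)%E -> faces_meeting S (face s).
Proof.
move=> S0 Ss sy near_y.
have Fs : faces (face s : set 'cV[R]_(n + n)) by exists s.
apply: contrapT => nmeet.
move: near_y; apply/negP; rewrite -leNgt.
apply: le_trans (_ : (set_dist (face s) S)%:E <= _)%E.
  by apply: ereal_inf_lbound; exists (face s).
by rewrite lee_fin set_dist_le_dist.
Qed.

(** The sign vectors are parametrised by the finite type of boolean functions
    so that the infimum can be bounded below by a finite minimum. *)
Lemma face_gap_gt0 S :
  (forall s, sign_vectors s -> ~ faces_meeting S (face s) ->
    0 < set_dist (face s) S) ->
  (0 < face_gap S)%E.
Proof.
move=> sep.
pose sgn (b : {ffun 'I_n -> bool}) : 'cV[int]_n := \col_i (-1) ^+ b i.
(* Faces that meet S get the harmless value 1. *)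
pose r b := if pselect (faces_meeting S (face (sgn b))) then 1
            else set_dist (face (sgn b)) S.
have r_gt0 b : 0 < r b.
  rewrite /r; case: pselect => // nmeet; apply: sep => // i.
  by rewrite mxE; case: (b i); rewrite ?expr0 ?expr1; [right|left].
pose e := \big[Num.min/1]_b r b.
have e_gt0 : 0 < e by apply/lt_bigmin.
apply: lt_le_trans (_ : 0 < e%:E)%E _; first by rewrite lte_fin.
apply/ereal_infP => _ [F [[s Ss <-] nmeet] <-]; rewrite lee_fin.
pose b : {ffun 'I_n -> bool} := [ffun i => s i 0 == -1].
have sb : sgn b = s.
  apply/matrixP => i j; rewrite (ord1 j) mxE ffunE.
  by case: (Ss i) => ->.
apply: le_trans (_ : r b <= _); first exact: bigmin_le.
by rewrite /r sb; case: pselect.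
Qed.

(** If u_i = v_i = 0, flipping s_i gives a second face through y; it would
    meet S as well, which the uniqueness of the face meeting S forbids.  Hence
    exactly one of u_i and v_i is positive, and vartheta agrees with chi. *)
Lemma vartheta_identified S s y : compl_set y -> sign_vectors s ->
  faces_meeting S = [set face s] ->
  (forall s', sign_vectors s' -> face s' y -> faces_meeting S (face s')) ->
  vartheta y = s.
Proof.
move=> Cy Ss only_s near_y.
have chis : chi y = s.
  apply: face_inj => //; first exact: sign_vectors_chi.
  have := near_y _ (sign_vectors_chi y) (mem_face_of Cy).
  by rewrite only_s.
have [u0 v0 uv] := Cy.
apply/matrixP => i j; rewrite (ord1 j) -chis /vartheta /chi mxE [RHS]mxE.
case: ifPn => [/orP[u_gt0|/andP[/eqP ui0 /eqP vi0]]|].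
- have /eqP -> : dsubmx y i 0 == 0.
    by move/eqP: (uv i); rewrite mulf_eq0 gt_eqF.
  by rewrite subr0 gtr0_sgz.
- pose s' : 'cV[int]_n := \col_k (if k == i then -1 else s k 0).
  have Ss' : sign_vectors s'.
    by move=> k; rewrite mxE; case: ifP => _; [right|exact: Ss].
  have s'y : face s' y.
    split=> // k; rewrite mxE; case: eqP => [->|_]; first by split.
    by rewrite -chis; case: (mem_face_of Cy) => _ /(_ k).
  have := near_y _ Ss' s'y; rewrite only_s => /(face_inj Ss' Ss) ss'.
  move: (congr1 (fun t : 'cV[int]_n => t i 0) ss').
  by rewrite /= -chis /s' /chi mxE eqxx mxE ui0 vi0 ltxx eqxx.
- rewrite negb_or -leNgt negb_and => /andP[u_le0].
  have ui0 : usubmx y i 0 = 0 by apply: le_anti; rewrite u_le0 u0.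
  rewrite ui0 eqxx /= sub0r => vi0.
  by rewrite ltr0_sgz// oppr_lt0 lt_neqAle eq_sym vi0 v0.
Qed.

End Faces.

(** * Faces that miss the solution set are far from it *)

Section Separation.
Context {R : realType} {m n : nat}.
Variables (H : 'M[R]_(m, n + n)) (c : 'cV[R]_m).

(** Phi attains its minimum on K. *)
Lemma residual_bounded_below (K : set 'cV[R]_(n + n)) : compact K ->
  (forall z, K z -> H *m z <> c) ->
  exists2 e, 0 < e & forall z, K z -> e <= enorm (H *m z - c).
Proof.
move=> Kc Kres.
have [K0|/set0P K0] := eqVneq K set0.
  by exists 1 => // z; rewrite K0.
have Phic : {within K, continuous (Phi H c)}.
  by apply: continuous_subspaceT; exact: Phi_continuous.
have [z0 Kz0 z0min] := compact_EVT_min K0 Kc Phic.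
exists (enorm (H *m z0 - c)) => [|z Kz].
  rewrite lt_neqAle enorm_ge0 andbT; apply/eqP => /esym/enorm_eq0/eqP.
  by rewrite subr_eq0 => /eqP; apply: Kres; rewrite inE in Kz0.
rewrite !residual_sqrt_Phi ler_sqrt; last by rewrite mulr_ge0// Phi_ge0.
by rewrite ler_pM2l// z0min// inE.
Qed.

(** Only the points of F within distance 1 of the solutions matter.  They lie
    in a compact part K of F, on which the residual is at least some e > 0; and
    the residual of z is at most |H| * |z - w| for each solution w. *)
Lemma set_dist_solutions_gt0 (M : R) (F : set 'cV[R]_(n + n)) :
  F !=set0 -> closed F -> F `<=` compl_set ->
  solutions H c !=set0 -> (forall z, solutions H c z -> enorm z <= M) ->
  ~ (F `&` solutions H c !=set0) -> 0 < set_dist F (solutions H c).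
Proof.
move=> [z0 Fz0] Fcl FC [w0 Sw0] SM disj.
pose K := F `&` \bigcap_i [set z | `|z i 0| <= M + 1].
have Kcl : closed K.
  apply: closedI => //; apply: closed_bigI => i _.
  have ballcl : closed [set x : R | `|x| <= M + 1].
    apply: (@preimage_closed _ _ (fun x : R => `|x|) [set x | x <= M + 1]).
      by move=> x _; exact: norm_continuous.
    exact: closed_le.
  exact: (@closed_preim_coord _ _ i _ ballcl).
have [] := @residual_bounded_below K.
- by apply: (@compact_cV _ _ (M + 1)) => // z i [_ Kz]; exact: Kz.
- move=> z [Fz _] Hz; apply: disj; exists z; split=> //.
  by split=> //; exact: FC.
move=> e e0 Ke; set h := spectral_norm H.
have h0 : 0 <= h := spectral_norm_ge0 H.
(* h + 1 rather than h, so that the quotient makes sense when H = 0. *)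
apply: lt_le_trans (_ : 0 < Num.min 1 (e / (h + 1))) _.
  by rewrite lt_min ltr01 divr_gt0// ltr_wpDl.
apply: lb_le_inf; first by exists (enorm (z0 - w0)), z0 => //; exists w0.
move=> _ [z Fz [w Sw <-]]; rewrite ge_min.
have [//|zw1/=] := leP 1 (enorm (z - w)).
rewrite ler_pdivrMr ?ltr_wpDl//.
apply: le_trans (_ : enorm (H *m z - c) <= _).
  apply: Ke; split=> // i _ /=.
  rewrite -(subrK (w i 0) (z i 0)) (le_trans (ler_normD _ _))// addrC lerD//.
    exact: le_trans (coord_le_enorm w i) (SM w Sw).
  have := coord_le_enorm (z - w) i; rewrite !mxE => /le_trans; apply.
  exact: ltW.
have [_ <-] := Sw; rewrite -mulmxBr (le_trans (enorm_mulmx_le _ _))//.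
by rewrite mulrC ler_wpM2l ?enorm_ge0// lerDl.
Qed.

End Separation.

(** * The identification index *)

Section IdentificationIndex.
Context {R : realType}.

(** With M := max(1, 2C/g) the hypothesis is theta^(N/2) <= 1/M, and
    C / M <= g/2 < g when C > 0. *)
Lemma ident_index_bound (C g theta : R) (N : nat) :
  0 <= C -> 0 < g -> 0 < theta < 1 ->
  2 * ln (Num.max 1 (2 * C / g)) / ln theta^-1 <= N%:R ->
  C * theta `^ (N%:R / 2) < g.
Proof.
move=> C0 g0 /andP[theta0 theta1] Nbig.
set M := Num.max 1 (2 * C / g) in Nbig.
have M0 : 0 < M by rewrite lt_max ltr01.
have decay : theta `^ (N%:R / 2) <= M^-1.
  rewrite -ler_ln ?posrE ?powR_gt0 ?invr_gt0// ln_powR lnV ?posrE//.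
  move: Nbig; rewrite lnV ?posrE// ler_pdivrMr; last first.
    by rewrite oppr_gt0 ln_lt0// theta0.
  by move: (ln M) (ln theta) => a b; move: (N%:R) => x; nra.
apply: le_lt_trans (_ : _ <= C * M^-1) _; first by rewrite ler_wpM2l.
have [C_eq0|C_gt0] : C = 0 \/ 0 < C.
  by move: C0; rewrite le_eqVlt => /orP[/eqP|]; [left|right].
  by rewrite C_eq0 mul0r.
rewrite ltr_pdivrMr//; apply: lt_le_trans (_ : g * (2 * C / g) <= _).
  by rewrite mulrCA divff ?gt_eqF// mulr1 mulr2n mulrDl !mul1r ltrDl.
by rewrite ler_pM2l// le_max lexx orbT.
Qed.

Lemma is_ident_index_exists (C g theta : R) :
  0 <= C -> 0 < g -> 0 < theta < 1 ->
  exists2 K : nat, is_ident_index C theta g%:E K &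
    (K%:Z <= 1 + Num.ceil (2 * ln (Num.max 1 (2 * C / g)) / ln theta^-1))%R.
Proof.
move=> C0 g0 theta01.
set b := 2 * _ / _.
have b0 : 0 <= b.
  have /andP[theta0 theta1] := theta01.
  rewrite divr_ge0 ?mulr_ge0 ?ln_ge0 ?le_max ?lexx//.
  by rewrite invf_ge1// ltW.
have ceil0 : (0 <= Num.ceil b)%R.
  by rewrite ceil_ge0 (lt_le_trans _ b0)// ltrN10.
have Nbelow : (C * theta `^ (`|Num.ceil b|%N%:R / 2) < g).
  apply: ident_index_bound => //; rewrite -/b pmulrn gez0_abs//.
  exact: ceil_ge.
have [K Kbelow Kmin] := ex_minnP (ex_intro (fun k : nat =>
  C * theta `^ (k%:R / 2) < g) _ Nbelow).
exists K; first by split=> // _; split=> // k; rewrite lte_fin; exact: Kmin.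
apply: le_trans (_ : Num.ceil b <= _); last by rewrite lerDr.
by rewrite -(gez0_abs ceil0) lez_nat; exact: Kmin.
Qed.

End IdentificationIndex.

(** * Linear convergence of the algorithm *)

Section Iterates.
Context {R : realType} {m n : nat}.
Variables (H : 'M[R]_(m, n + n)) (c : 'cV[R]_m).
Variables (q : nat) (tau : R) (alpha : nat -> R).
Variables (y ybar : nat -> 'cV[R]_(n + n)).
Variables (cand : nat -> option 'cV[R]_(n + n)).
Hypothesis alg : safeguarded_pg H c q tau alpha y ybar cand.

(** Whatever the trigger and the refinement rule do, this is all that the
    convergence proof retains of an iteration. *)
Lemma safeguarded_next k : y k.+1 = ybar k.+1 \/
  compl_set (y k.+1) /\ Phi H c (y k.+1) <= Phi H c (ybar k.+1).
Proof.
have [[trig [z [candz Cz Phiz]]]|rej] := pselect (trigger H c q tau y ybar k /\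
    exists z, [/\ cand k.+1 = Some z, compl_set z &
                  Phi H c z <= Phi H c (ybar k.+1)]).
  by right; rewrite (spg_accept alg trig candz Cz Phiz).
by left; exact: spg_reject alg _ rej.
Qed.

Lemma iterate_feasible k : compl_set (y k).
Proof.
case: k => [|k]; first exact: spg_init alg.
case: (safeguarded_next k) => [->|[]//].
by have [] := spg_step alg k.
Qed.

Lemma iterate_le_trial k : Phi H c (y k.+1) <= Phi H c (ybar k.+1).
Proof. by case: (safeguarded_next k) => [->|[]]. Qed.

Lemma trial_feasible k : compl_set (ybar k.+1).
Proof. by have [] := spg_step alg k. Qed.

(** The contraction is only assumed on the initial level set, where the error
    bounds hold; the decay itself keeps the iterates there.  The trial point
    is stated with the exponent k instead of k + 1, so that both points of an
    iteration satisfy the same bound. *)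
Lemma iterate_linear_decay theta : 0 <= theta <= 1 ->
  (forall k, Phi H c (y k) <= Phi H c (y 0%N) ->
    Phi H c (ybar k.+1) <= theta * Phi H c (y k)) ->
  forall k, Phi H c (y k) <= theta ^+ k * Phi H c (y 0%N) /\
    Phi H c (ybar k.+1) <= theta ^+ k * Phi H c (y 0%N).
Proof.
move=> /andP[theta0 theta1] contr.
have below k : theta ^+ k * Phi H c (y 0%N) <= Phi H c (y 0%N).
  by rewrite ler_piMl ?Phi_ge0// exprn_ile1.
have trial k : Phi H c (y k) <= theta ^+ k * Phi H c (y 0%N) ->
    Phi H c (ybar k.+1) <= theta ^+ k.+1 * Phi H c (y 0%N).
  move=> yk; apply: le_trans (contr k (le_trans yk (below k))) _.
  by rewrite exprS -mulrA ler_wpM2l.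
have iter k : Phi H c (y k) <= theta ^+ k * Phi H c (y 0%N).
  elim: k => [|k IHk]; first by rewrite expr0 mul1r.
  exact: le_trans (iterate_le_trial k) (trial k IHk).
move=> k; split=> //; apply: le_trans (trial k (iter k)) _.
by rewrite exprS -mulrA ler_piMl// mulr_ge0 ?exprn_ge0 ?Phi_ge0.
Qed.

End Iterates.

(** The exponent is halved because the residual is the square root of
    2 * Phi. *)
Lemma dist_solutions_decay (R : realType) (m n : nat) (H : 'M[R]_(m, n + n))
    (c : 'cV[R]_m) (kr theta : R) (k : nat) (y0 z : 'cV[R]_(n + n)) :
  0 <= kr -> 0 <= theta ->
  dist z (solutions H c) <= kr * enorm (H *m z - c) ->
  Phi H c z <= theta ^+ k * Phi H c y0 ->
  dist z (solutions H c) <=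
    kr * Num.sqrt (2 * Phi H c y0) * theta `^ (k%:R / 2).
Proof.
move=> kr0 theta0 eb decay; apply: le_trans eb _.
rewrite powRrM powR_mulrn// powR12_sqrt ?exprn_ge0//.
rewrite -mulrA ler_wpM2l// residual_sqrt_Phi -sqrtrM; last first.
  by rewrite mulr_ge0 ?Phi_ge0.
rewrite ler_sqrt; last by rewrite mulr_ge0 ?exprn_ge0// mulr_ge0 ?Phi_ge0.
by rewrite -mulrA ler_pM2l// (mulrC _ (theta ^+ k)).
Qed.

(** * Finite identification *)

Theorem theorem6 (R : realType) (m n : nat) (P Q : 'M[R]_(m, n))
    (c : 'cV[R]_m) (q : nat) (tau : R) (alpha : nat -> R)
    (y ybar : nat -> 'cV[R]_(n + n)) (cand : nat -> option 'cV[R]_(n + n))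
    (alo ahi : R) (A : set R) (kr kG : R) :
  let H := row_mx P Q in
  let L := spectral_norm H ^+ 2 in
  let S := solutions H c in
  let L0 := level_set H c (y 0%N) in
  let cd := (2 * ahi)^-1 - L / 2 in
  let eta := 2 * cd * alo ^+ 2 / (L * kG ^+ 2) in
  let theta := 1 - eta in
  let C0 := kr * Num.sqrt (2 * Phi H c (y 0%N)) in
  let gap := face_gap S in
  0 < L ->
  (1 <= q)%N ->
  0 <= tau ->
  safeguarded_pg H c q tau alpha y ybar cand ->
  0 < alo ->
  (forall k, alo <= alpha k <= ahi) ->
  ahi < L^-1 ->
  S !=set0 ->
  (exists M : R, forall z, L0 z -> enorm z <= M) ->
  \bigcup_(a in [set a : R | 0 < a])
    [set z | compl_set z /\ pg_step H c a z z] `<=` S ->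
  finite_set A ->
  A !=set0 ->
  A `<=` `[alo, ahi] ->
  (forall k, A (alpha k)) ->
  0 < kr ->
  (forall z, L0 z -> dist z S <= kr * enorm (H *m z - c)) ->
  0 < kG ->
  (forall z a, L0 z -> A a -> dist z S <= kG * grad_residual H c a z) ->
  0 < eta < 1 ->
  exists2 Kid : nat, is_ident_index C0 theta gap Kid &
    [/\ forall k, (Kid <= k)%N ->
          faces_meeting S (face_of (y k)) /\
          faces_meeting S (face_of (ybar k.+1)),
        (gap < +oo)%E ->
          (Kid%:Z <= 1 + Num.ceil
            (2 * ln (Num.max 1 (2 * C0 / fine gap)) / ln (theta^-1)))%R &
        forall FS, faces_meeting S = [set FS] ->
          (forall k, (Kid <= k)%N ->
             face_of (y k) = FS /\ face_of (ybar k.+1) = FS) /\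
          (exists2 thetaS : 'cV[int]_n, sign_vectors thetaS &
             forall k, (Kid <= k)%N ->
               vartheta (y k) = thetaS /\ vartheta (ybar k.+1) = thetaS)].
Proof.
move=> H L S L0 cd eta theta C0 gap Lgt0 _ _ alg alo0 alpha_bnd ahiL Sn0
  [M L0M] _ _ _ _ alphaA kr0 eb_r kG0 eb_G /andP[eta0 eta1].
have theta01 : 0 < theta < 1 by rewrite subr_gt0 eta1 gtrBl.
have /andP[theta0 theta1] := theta01.
have C0_ge0 : 0 <= C0 by rewrite mulr_ge0 ?(ltW kr0)// sqrtr_ge0.
have yC := iterate_feasible alg; have ybarC := trial_feasible alg.
have decay k : Phi H c (y k) <= theta ^+ k * Phi H c (y 0%N) /\
    Phi H c (ybar k.+1) <= theta ^+ k * Phi H c (y 0%N).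
  apply: (iterate_linear_decay alg); first by rewrite !ltW.
  move=> {}k yk.
  apply: (Phi_contraction Sn0 Lgt0 (yC k) (spg_step alg k)) => //.
  by apply: eb_G => //; split.
have dist_decay k z : compl_set z ->
    Phi H c z <= theta ^+ k * Phi H c (y 0%N) ->
    dist z S <= C0 * theta `^ (k%:R / 2).
  move=> Cz Phiz; apply: dist_solutions_decay (Phiz); [exact: ltW..|].
  apply: eb_r; split=> //; apply: le_trans Phiz _.
  by rewrite ler_piMl ?Phi_ge0// exprn_ile1 ?ltW.
have gap0 : (0 < gap)%E.
  apply: face_gap_gt0 => s Ss nmeet.
  apply: (@set_dist_solutions_gt0 _ _ _ _ _ M) => //.
  - by exists 0; exact: face0.
  - exact: closed_face.
  - by move=> z [].
  - move=> z [Cz Hz]; apply: L0M; split=> //.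
    by rewrite /Phi Hz subrr enorm0 expr0n mulr0 Phi_ge0.
  - by move=> meet; apply: nmeet; split=> //; exists s.
have [Kid Kid_ident Kid_bound] : exists2 Kid : nat,
    is_ident_index C0 theta gap Kid & (gap < +oo)%E ->
      (Kid%:Z <= 1 + Num.ceil
            (2 * ln (Num.max 1 (2 * C0 / fine gap)) / ln (theta^-1)))%R.
  case: gap gap0 => [g g0|_|//].
    have [K HK Kb] := is_ident_index_exists C0_ge0 g0 theta01.
    by exists K.
  by exists 0%N.
have identified k z s : (Kid <= k)%N -> compl_set z ->
    Phi H c z <= theta ^+ k * Phi H c (y 0%N) ->
    sign_vectors s -> face s z -> faces_meeting S (face s).
  move=> Kk Cz Phiz Ss sz; apply: near_face_meets sz _ => //.
  apply: le_lt_trans (_ : _ <= (C0 * theta `^ (k%:R / 2))%:E)%E _.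
    by rewrite lee_fin dist_decay.
  have [gap_fin gap_infty] := Kid_ident.
  have [gap_lt|] := ltP gap +oo%E; last first.
    by rewrite leye_eq -/gap => /eqP ->; rewrite ltry.
  apply: le_lt_trans (gap_fin gap_lt).1; rewrite lee_fin ler_wpM2l//.
  apply: ger_powR; first by rewrite theta0 ltW.
  by rewrite ler_pM2r ?invr_gt0// ler_nat.
have identified_face k z : (Kid <= k)%N -> compl_set z ->
    Phi H c z <= theta ^+ k * Phi H c (y 0%N) ->
    faces_meeting S (face_of z).
  move=> Kk Cz Phiz; apply: (identified k z) => //.
    exact: sign_vectors_chi.
  exact: mem_face_of.
exists Kid => //; split=> // [k Kk|FS FS_only].
  by have [Phiy Phiybar] := decay k; split; exact: (identified_face k).
have FS_of k z : (Kid <= k)%N -> compl_set z ->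
    Phi H c z <= theta ^+ k * Phi H c (y 0%N) -> face_of z = FS.
  by move=> Kk Cz Phiz; have := identified_face k z Kk Cz Phiz; rewrite FS_only.
split=> [k Kk|].
  by have [Phiy Phiybar] := decay k; split; exact: (FS_of k).
have [[s Ss sFS] _] : faces_meeting S FS by rewrite FS_only.
exists s => // k Kk; have [Phiy Phiybar] := decay k.
have FSs : faces_meeting S = [set face s] by rewrite sFS.
split; apply: (@vartheta_identified _ _ S) => //.
- by move=> s' Ss' s'z; exact: (identified k (y k)).
- by move=> s' Ss' s'z; exact: (identified k (ybar k.+1)).
Qed.
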